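(* Let $\mathbb{F}$ be an infinite field of arbitrary characteristic and let $d\geq 1$. The set $$S(d)=\{\mathrm{tr}(X_i),\ \det(X_i)\ (1\leq i\leq d)\}\cup\{\mathrm{tr}(X_iX_j)\ (1\leq i<j\leq d)\}\cup\{\mathrm{tr}(X_iX_jX_k)\ (1\leq i<j<k\leq d)\}$$ is a separating set for the algebra of matrix invariants $R^{GL(2)}$, and it is minimal with respect to inclusion: no proper subset of $S(d)$ is separating.
   Context: Let $R=R_{2,d}=\mathbb{F}[x_{ij}(k)\mid 1\leq i,j\leq 2,\ 1\leq k\leq d]$ and let $X_k=(x_{ij}(k))_{1\le i,j\le 2}$ be the $2\times 2$ generic matrices. The group $GL(2)$ acts on $R$ by $g\cdot x_{ij}(k)=(g^{-1}X_kg)_{ij}$, and $R^{GL(2)}$ is the subalgebra of invariants. Let $H=M(2)^{\oplus d}$ be the space of $d$-tuples of $2\times 2$ matrices over $\mathbb{F}$; an element $f\in R$ is viewed as a polynomial function on $H$ via $x_{ij}(k)(A_1,\dots,A_d)=(A_k)_{ij}$. Two points $u,v\in H$ are separated by a subset $S\subseteq R^{GL(2)}$ if some $f\in S$ satisfies $f(u)\neq f(v)$; they are separated if they are separated by $R^{GL(2)}$. A subset $S\subseteq R^{GL(2)}$ is separating if any $u,v\in H$ that are separated are separated by $S$. *)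

(* Defs.v *)
From HB Require Import structures.
From mathcomp Require Import all_boot all_order all_algebra.
Set Implicit Arguments. Unset Strict Implicit. Unset Printing Implicit Defensive.
Import GRing.Theory.
Local Open Scope ring_scope.

Definition infinite_field (F : fieldType) : Prop :=
  forall s : seq F, exists x : F, x \notin s.

Definition H (F : fieldType) (d : nat) := 'I_d -> 'M[F]_2.

(* Elements of R = F[x_ij(k)], as polynomial expressions. *)
Inductive pexpr (F : fieldType) (d : nat) : Type :=
| PConst : F -> pexpr F d
| PVar : 'I_2 -> 'I_2 -> 'I_d -> pexpr F d
| PAdd : pexpr F d -> pexpr F d -> pexpr F d
| PMul : pexpr F d -> pexpr F d -> pexpr F d.

Fixpoint peval (F : fieldType) (d : nat) (p : pexpr F d) (A : H F d) : F :=
  match p with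
  | PConst c => c
  | PVar i j k => A k i j
  | PAdd p q => peval p A + peval q A
  | PMul p q => peval p A * peval q A
  end.

Definition gact (F : fieldType) (d : nat) (g : 'M[F]_2) (A : H F d) : H F d :=
  fun k => invmx g *m A k *m g.

Definition gl2_invariant (F : fieldType) (d : nat) (p : pexpr F d) : Prop :=
  forall g : 'M[F]_2, g \in unitmx -> forall A : H F d,
    peval p (gact g A) = peval p A.

Definition separated (F : fieldType) (d : nat) (u v : H F d) : Prop :=
  exists p : pexpr F d, gl2_invariant p /\ peval p u <> peval p v.

(* Subsets S of R^{GL(2)} are represented by the polynomial functions of their
   elements (F infinite, so polynomials = polynomial functions). *)
Definition separating (F : fieldType) (d : nat) (S : (H F d -> F) -> Prop) : Prop :=
  forall u v : H F d, separated u v -> exists f, S f /\ f u <> f v.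

Definition S_d (F : fieldType) (d : nat) (f : H F d -> F) : Prop :=
  (exists i : 'I_d, f = fun A => \tr (A i)) \/
  (exists i : 'I_d, f = fun A => \det (A i)) \/
  (exists i j : 'I_d, (i < j)%N /\ f = fun A => \tr (A i *m A j)) \/
  (exists i j k : 'I_d, (i < j)%N /\ (j < k)%N /\
                        f = fun A => \tr (A i *m A j *m A k)).

(* Main.v *)
(* Suppose that u and v agree on S(d).  If some pair u_i, u_j has
   det [u_i, u_j] <> 0, it generates M_2(F) and is determined up to conjugacy by
   its traces and determinants; the trace form then determines the other u_k.
   If all these determinants vanish but tr(u_i u_j u_k) <> tr(u_j u_i u_k), the
   same applies to the pair u_i, u_j + u_k.  Otherwise either the u_k have a
   common eigenvector over F, and every invariant takes the same value at u and
   at its diagonal degeneration, or the u_k lie in a quadratic field extension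
   F[u_i], where the norm separates.  The two situations are told apart by the
   characteristic polynomials, and no extension of scalars is needed. *)
Require Import Defs.
From mathcomp Require Import all_boot all_order all_algebra.
From mathcomp Require Import ring zify.

Set Implicit Arguments. Unset Strict Implicit. Unset Printing Implicit Defensive.
Import GRing.Theory.
Local Open Scope ring_scope.

(** * Coordinates for 2 by 2 matrices *)

Section TwoByTwo.
Variable F : fieldType.
Implicit Types (A B C N M g h : 'M[F]_2) (a b c x y : F).

Definition mx2 a b c x : 'M[F]_2 :=
  \matrix_(i, j) if i == 0 then (if j == 0 then a else b)
                 else (if j == 0 then c else x).

Lemma mx2E a b c x :
  (mx2 a b c x 0 0 = a) * (mx2 a b c x 0 1 = b) *
  (mx2 a b c x 1 0 = c) * (mx2 a b c x 1 1 = x).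
Proof. by rewrite !mxE. Qed.

Lemma ord2P (P : 'I_2 -> Prop) : P 0 -> P 1 -> forall i, P i.
Proof.
move=> P0 P1 [[|[|//]] lti].
  by rewrite (_ : Ordinal lti = 0) //; apply: val_inj.
by rewrite (_ : Ordinal lti = 1) //; apply: val_inj.
Qed.

Lemma eq_mx2 A B : A 0 0 = B 0 0 -> A 0 1 = B 0 1 -> A 1 0 = B 1 0 ->
  A 1 1 = B 1 1 -> A = B.
Proof. by move=> *; apply/matrixP; apply: ord2P; apply: ord2P. Qed.

Lemma mx2_eta A : A = mx2 (A 0 0) (A 0 1) (A 1 0) (A 1 1).
Proof. by apply: eq_mx2; rewrite mx2E. Qed.

Lemma mx2_ind (P : 'M[F]_2 -> Prop) :
  (forall a b c x, P (mx2 a b c x)) -> forall A, P A.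
Proof. by move=> PP A; rewrite (mx2_eta A). Qed.

Lemma mxtrace2 A : \tr A = A 0 0 + A 1 1.
Proof. by rewrite /mxtrace big_ord_recl big_ord1; congr (_ + A _ _); apply: val_inj. Qed.

Lemma mulmx2 A B i j : (A *m B) i j = A i 0 * B 0 j + A i 1 * B 1 j.
Proof.
rewrite mxE big_ord_recl big_ord1.
by congr (_ + A _ _ * B _ _); apply: val_inj.
Qed.

Lemma det2 A : \det A = A 0 0 * A 1 1 - A 0 1 * A 1 0.
Proof. rewrite (expand_det_row _ 0) big_ord_recl big_ord1 /cofactor !det_mx11 !mxE /=.
rewrite mul1r mulN1r mulrN.
by congr (_ * A _ _ - A _ _ * A _ _); apply: val_inj. Qed.

Lemma scalar2 a : (a%:M : 'M[F]_2) = mx2 a 0 0 a.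
Proof. by apply: eq_mx2; rewrite mx2E !mxE ?mulr1n ?mulr0n. Qed.

Lemma mul_mx2 a b c x a' b' c' x' :
  mx2 a b c x *m mx2 a' b' c' x' =
  mx2 (a * a' + b * c') (a * b' + b * x') (c * a' + x * c') (c * b' + x * x').
Proof. by apply: eq_mx2; rewrite mulmx2 !mx2E. Qed.

Lemma add_mx2 a b c x a' b' c' x' :
  mx2 a b c x + mx2 a' b' c' x' = mx2 (a + a') (b + b') (c + c') (x + x').
Proof. by apply: eq_mx2; rewrite mxE !mx2E. Qed.

Lemma opp_mx2 a b c x : - mx2 a b c x = mx2 (- a) (- b) (- c) (- x).
Proof. by apply: eq_mx2; rewrite mxE !mx2E. Qed.

Lemma scale_mx2 y a b c x : y *: mx2 a b c x = mx2 (y * a) (y * b) (y * c) (y * x).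
Proof. by apply: eq_mx2; rewrite mxE !mx2E. Qed.

Lemma tr_mx2 a b c x : \tr (mx2 a b c x) = a + x.
Proof. by rewrite mxtrace2 !mx2E. Qed.

Lemma det_mx2 a b c x : \det (mx2 a b c x) = a * x - b * c.
Proof. by rewrite det2 !mx2E. Qed.

Lemma inj_mx2 a b c x a' b' c' x' : mx2 a b c x = mx2 a' b' c' x' ->
  [/\ a = a', b = b', c = c' & x = x'].
Proof.
move=> e; split.
- by have := congr1 (fun A : 'M_2 => A 0 0) e; rewrite !mx2E.
- by have := congr1 (fun A : 'M_2 => A 0 1) e; rewrite !mx2E.
- by have := congr1 (fun A : 'M_2 => A 1 0) e; rewrite !mx2E.
- by have := congr1 (fun A : 'M_2 => A 1 1) e; rewrite !mx2E.
Qed.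

Definition mx2S := (mul_mx2, opp_mx2, add_mx2, scale_mx2, tr_mx2, det_mx2).

Lemma unitmx2 A : (A \in unitmx) = (\det A != 0).
Proof. by rewrite unitmxE unitfE. Qed.

(** * Commutators and trace identities *)

Definition cmx A B := A *m B - B *m A.

Lemma tr_sqr A : \tr (A *m A) = (\tr A) ^+ 2 - 2%:R * \det A.
Proof. by elim/mx2_ind: A => *; rewrite !mx2S; ring. Qed.

(** Cayley-Hamilton for [A], multiplied by [B]. *)
Lemma tr_sqr_mul A B : \tr (A *m A *m B) = \tr A * \tr (A *m B) - \det A * \tr B.
Proof. by elim/mx2_ind: A => *; elim/mx2_ind: B => *; rewrite !mx2S; ring. Qed.

Lemma detD2 A B : \det (A + B) = \det A + \det B + \tr A * \tr B - \tr (A *m B).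
Proof. by elim/mx2_ind: A => *; elim/mx2_ind: B => *; rewrite !mx2S; ring. Qed.

(** Polarized Cayley-Hamilton, with [A B + B A] expressed through [A], [B] and scalars, multiplied
    by [C]. It lets triple traces be sorted, at the cost of shorter traces. *)
Lemma tr_mulCA A B C : \tr (B *m A *m C) = - \tr (A *m B *m C)
  + \tr A * \tr (B *m C) + \tr B * \tr (A *m C) + \tr C * \tr (A *m B)
  - \tr A * \tr B * \tr C.
Proof.
by elim/mx2_ind: A => *; elim/mx2_ind: B => *; elim/mx2_ind: C => *;
  rewrite !mx2S; ring.
Qed.

(** This determinant vanishes exactly when [A] and [B] share an eigenvector over an algebraic
    closure. The formula shows that agreeing tuples have the same irreducible pairs. *)
Lemma det_cmx A B : \det (cmx A B) =
  4%:R * \det A * \det B - (\tr A) ^+ 2 * \det B - (\tr B) ^+ 2 * \det A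
  - (\tr (A *m B)) ^+ 2 + \tr A * \tr B * \tr (A *m B).
Proof.
by rewrite /cmx; elim/mx2_ind: A => *; elim/mx2_ind: B => *; rewrite !mx2S; ring.
Qed.

Lemma tr_cmx A B : \tr (cmx A B) = 0.
Proof. by rewrite /cmx raddfB /= mxtrace_mulC subrr. Qed.

Lemma tr_cmx_mul A B C : \tr (cmx A B *m C) = \tr (A *m B *m C) - \tr (B *m A *m C).
Proof. by rewrite /cmx mulmxBl raddfB. Qed.

Lemma cmx0P A B : reflect (A *m B = B *m A) (cmx A B == 0).
Proof. by rewrite subr_eq0; apply: eqP. Qed.

Lemma cmx_scalar A B : cmx A B != 0 -> ~~ is_scalar_mx A.
Proof.
by apply: contra => /is_scalar_mxP [a ->]; apply/cmx0P; rewrite scalar_mxC.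
Qed.

(** * Companion matrices and irreducible pairs *)

Definition companion t d := mx2 0 (- d) 1 t.

(** A non-scalar matrix has a cyclic vector [w] among [e1], [e2] and [e1 + e2]; the columns of [g]
    are [w] and [A w]. *)
Lemma companion_conj A : ~~ is_scalar_mx A ->
  exists2 g, g \in unitmx & A *m g = g *m companion (\tr A) (\det A).
Proof.
rewrite /companion; elim/mx2_ind: A => a b c x nsc.
have [c0|c0] := eqVneq c 0; last first.
  exists (mx2 1 a 0 c); first by rewrite unitmx2 !mx2S mul1r mulr0 subr0.
  by rewrite !mx2S; congr mx2; ring.
have [b0|b0] := eqVneq b 0; last first.
  exists (mx2 0 b 1 x); first by rewrite unitmx2 !mx2S mul0r mulr1 sub0r oppr_eq0.
  by rewrite !mx2S; congr mx2; ring.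
exists (mx2 1 a 1 x); last by rewrite c0 b0 !mx2S; congr mx2; ring.
rewrite unitmx2 !mx2S mul1r mulr1 subr_eq0.
by apply: contraNneq nsc => ->; rewrite c0 b0 -scalar2 scalar_mx_is_scalar.
Qed.

(** The vector [e1] is cyclic for the companion matrix, so a commuting [B] is determined by its
    first column [B e1]. *)
Lemma comm_companion t d B : companion t d *m B = B *m companion t d ->
  B = (B 0 0)%:M + B 1 0 *: companion t d.
Proof.
rewrite scalar2 /companion; elim/mx2_ind: B => a b c x.
rewrite !mx2S => /inj_mx2 [e1 _ e2 _]; rewrite !mx2E; congr mx2.
- ring.
- transitivity (a * 0 + b * 1); first by ring.
  by rewrite -e1; ring.
- ring.
- transitivity (c * 0 + x * 1); first by ring.
  by rewrite -e2; ring.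
Qed.

(* [g = x + y C] with [B g = g B'] gives [y [C, B] = [g, B] = g (B - B')],
   so a singular [g] would force [det [C, B] = 0]. *)
Lemma companion_irr t d B B' (C := companion t d) :
  \tr B = \tr B' -> \det B = \det B' -> \tr (C *m B) = \tr (C *m B') ->
  \det (cmx C B) != 0 ->
  exists g, [/\ g \in unitmx, C *m g = g *m C & B *m g = g *m B'].
Proof.
move=> eT eD eC nz.
have key x y (g := x%:M + y *: C) : y != 0 -> B *m g = g *m B' ->
    exists g, [/\ g \in unitmx, C *m g = g *m C & B *m g = g *m B'].
  move=> y0 eg; exists g; split=> //; last first.
    by rewrite mulmxDl mulmxDr -scalemxAl -scalemxAr scalar_mxC.
  rewrite unitmx2; apply: contra_neq nz => g0.
  have e : y *: cmx C B = g *m (B - B').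
    rewrite mulmxBr -eg /g mulmxDl mulmxDr -scalemxAl -scalemxAr scalar_mxC.
    by rewrite opprD addrACA subrr add0r -scalerBr.
  have := congr1 determinant e; rewrite det_mulmx g0 mul0r detZ => /eqP.
  by rewrite mulf_eq0 expf_eq0 (negPf y0) andbF => /eqP.
move: key eT eD eC; rewrite {nz}/C /companion.
elim/mx2_ind: B => p q r s; elim/mx2_ind: B' => p' q' r' s' key.
rewrite !mx2S => eT eD eC.
have es : s' = p + s - p' by rewrite eT; ring.
have eq : q' = q - d * r + t * s + d * r' - t * s'.
  transitivity (0 * p + - d * r + (1 * q + t * s) + d * r' - t * s'); last by ring.
  by rewrite eC; ring.
have eD0 : p * s - q * r - (p' * s' - q' * r') = 0 by rewrite eD subrr.
rewrite {eT eC eD}eq {}es in eD0 key *.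
set E := _ - _ in eD0.
have lin k x y : x - y = k * E -> x = y.
  by rewrite eD0 mulr0 => /eqP; rewrite subr_eq0 => /eqP.
(* The first column of [B g = g B'] reads [(p - p') x + (q + d r') y = 0] and
   [(r - r') x + (s - p' - t r') y = 0]. Each choice of [(x, y)] below solves one of these; the
   other entries hold because [E = 0]. *)
have [pp|pp] := eqVneq p p'; last first.
  apply: (key (q + d * r') (p' - p)); first by rewrite subr_eq0 eq_sym.
  rewrite scalar2 !mx2S /E; congr mx2.
  - ring.
  - by apply: (lin (- d)); rewrite /E; ring.
  - by apply: (lin (- 1)); rewrite /E; ring.
  - ring.
have [rr|rr] := eqVneq r r'; last first.
  apply: (key (s - p' - t * r') (r' - r)); first by rewrite subr_eq0 eq_sym.
  rewrite scalar2 !mx2S; congr mx2.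
  - by apply: (lin 1); rewrite /E; ring.
  - by apply: (lin t); rewrite /E; ring.
  - ring.
  - by apply: (lin (- 1)); rewrite /E; ring.
exists 1%:M; rewrite unitmx1 !mulmx1 !mul1mx; split=> //.
by rewrite -pp -rr; congr mx2; ring.
Qed.

(* As [det (cmx A B) != 0], the trace form pairs [1, A, B, A B] perfectly with
   the whole matrix algebra. *)
Lemma trace_form_nondeg A B C : \det (cmx A B) != 0 ->
  \tr C = 0 -> \tr (A *m C) = 0 -> \tr (B *m C) = 0 ->
  \tr (A *m B *m C) = 0 -> C = 0.
Proof.
rewrite /cmx; elim/mx2_ind: A => a1 a2 a3 a4; elim/mx2_ind: B => b1 b2 b3 b4.
elim/mx2_ind: C => x y z x4; rewrite !mx2S => nz e.
have {e}-> : x4 = - x by apply/eqP; rewrite -addr_eq0 addrC e.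
set p1 := a1 * b1 + a2 * b3; set p2 := a1 * b2 + a2 * b4.
set p3 := a3 * b1 + a4 * b3; set p4 := a3 * b2 + a4 * b4.
set fA := _ + _ => eA; set fB := _ + _ => eB; set fC := _ + _ => eC.
move: nz; set D := _ - _ => nz.
(* [D] is also the determinant of the linear system [fA = fB = fC = 0] in [x, y, z]; the multipliers
   given to [cramer] are its cofactors. *)
have cramer k1 k2 k3 c : D * c = k1 * fA + k2 * fB + k3 * fC -> c = 0.
  rewrite eA eB eC !mulr0 !addr0 => /eqP.
  by rewrite mulf_eq0 (negPf nz) => /eqP.
have -> : x = 0.
  apply: (cramer (b3 * (p2) - b2 * p3) (p3 * a2 - p2 * a3) (a3 * b2 - a2 * b3)).
  by rewrite /D /fA /fB /fC /p1 /p2 /p3 /p4; ring.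
have -> : y = 0.
  apply: (cramer (b2 * (p1 - p4) - (b1 - b4) * p2) (p2 * (a1 - a4) - (p1 - p4) * a2)
    (a2 * (b1 - b4) - (a1 - a4) * b2)).
  by rewrite /D /fA /fB /fC /p1 /p2 /p3 /p4; ring.
have -> : z = 0.
  apply: (cramer ((b1 - b4) * p3 - b3 * (p1 - p4)) ((p1 - p4) * a3 - p3 * (a1 - a4))
    ((a1 - a4) * b3 - a3 * (b1 - b4))).
  by rewrite /D /fA /fB /fC /p1 /p2 /p3 /p4; ring.
by apply: eq_mx2; rewrite !mx2E ?mxE ?oppr0.
Qed.

(** [A] and [A'] have the same companion matrix [c]; once both are brought to it, [companion_irr]
    matches the second entries inside the centralizer of [c]. *)
Lemma irr_conj A B A' B' :
  \tr A = \tr A' -> \det A = \det A' -> \tr B = \tr B' -> \det B = \det B' ->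
  \tr (A *m B) = \tr (A' *m B') -> \det (cmx A B) != 0 ->
  exists g, [/\ g \in unitmx, A *m g = g *m A' & B *m g = g *m B'].
Proof.
move=> tA dA tB dB tAB nz.
have nz' : \det (cmx A' B') != 0 by rewrite det_cmx -tA -dA -tB -dB -tAB -det_cmx.
have cnz X Y : \det (cmx X Y) != 0 -> cmx X Y != 0.
  by apply: contra_neq => ->; rewrite det0.
have [h hu eh] := companion_conj (cmx_scalar (cnz _ _ nz)).
have [h' hu' eh'] := companion_conj (cmx_scalar (cnz _ _ nz')).
rewrite -tA -dA in eh'; set c := companion _ _ in eh eh'.
pose X := invmx h *m B *m h; pose X' := invmx h' *m B' *m h'.
have eX : B *m h = h *m X by rewrite /X !mulmxA mulmxV // mul1mx.
have eX' : B' *m h' = h' *m X' by rewrite /X' !mulmxA mulmxV // mul1mx.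
have trJ (k Y Z : 'M[F]_2) : k \in unitmx -> Y *m k = k *m Z -> \tr Y = \tr Z.
  by move=> ku e; rewrite -[Y](mulmxK ku) e mxtrace_mulC mulmxA mulVmx // mul1mx.
have detJ (k Y Z : 'M[F]_2) : k \in unitmx -> Y *m k = k *m Z -> \det Y = \det Z.
  move=> ku /(congr1 determinant); rewrite !det_mulmx mulrC.
  by apply: mulfI; rewrite -unitmx2.
have mulJ (k Y Z Y' Z' : 'M[F]_2) : Y *m k = k *m Z -> Y' *m k = k *m Z' ->
    Y *m Y' *m k = k *m (Z *m Z').
  by move=> e e'; rewrite -mulmxA e' mulmxA e mulmxA.
have [] := @companion_irr (\tr A) (\det A) X X'; rewrite -/c.
- by rewrite -(trJ _ _ _ hu eX) -(trJ _ _ _ hu' eX').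
- by rewrite -(detJ _ _ _ hu eX) -(detJ _ _ _ hu' eX').
- by rewrite -(trJ _ _ _ hu (mulJ _ _ _ _ _ eh eX))
     -(trJ _ _ _ hu' (mulJ _ _ _ _ _ eh' eX')).
- rewrite -(detJ h (cmx A B)) // /cmx mulmxBl mulmxBr.
  by rewrite (mulJ _ _ _ _ _ eh eX) (mulJ _ _ _ _ _ eX eh).
move=> g [gu eg egX]; exists (h *m g *m invmx h').
rewrite !unitmx_mul unitmx_inv hu gu hu'.
have compJ (Y Z Y' Z' : 'M[F]_2) : Y *m h = h *m Z -> Y' *m h' = h' *m Z' ->
    Z *m g = g *m Z' -> Y *m (h *m g *m invmx h') = h *m g *m invmx h' *m Y'.
  move=> e e' eg'; apply: (can_inj (mulmxK hu')).
  by rewrite !mulmxA mulmxKV // e -(mulmxA h Z) eg' -[RHS]mulmxA e' !mulmxA mulmxKV.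
by split=> //; [apply: compJ eh eh' eg | apply: compJ eX eX' egX].
Qed.

(** * Eigenlines and nilpotent matrices *)

Lemma conj_lower_left h C : h \in unitmx ->
  h 0 0 * (C 1 0 * h 0 0 + C 1 1 * h 1 0) =
  h 1 0 * (C 0 0 * h 0 0 + C 0 1 * h 1 0) -> (invmx h *m C *m h) 1 0 = 0.
Proof.
move=> hu e; have : h *m (invmx h *m C *m h) = C *m h by rewrite -mulmxA mulKVmx.
move: (invmx h *m C *m h) => U eU.
have := congr1 (fun X : 'M_2 => X 0 0) eU; have := congr1 (fun X : 'M_2 => X 1 0) eU.
rewrite !mulmx2 => e1 e0; rewrite -e0 -e1 in e.
(* With [w] the first column of [h], [det h * U 1 0] is the determinant of the columns [w] and
   [C w], which the hypothesis makes zero. *)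
rewrite unitmx2 in hu; apply: (mulfI hu); rewrite mulr0 det2.
transitivity (h 0 0 * (h 1 0 * U 0 0 + h 1 1 * U 1 0) -
  h 1 0 * (h 0 0 * U 0 0 + h 0 1 * U 1 0)); first by ring.
by rewrite e subrr.
Qed.

Lemma conj_first_col (x y : F) : (x != 0) || (y != 0) ->
  exists h, [/\ h \in unitmx, h 0 0 = x & h 1 0 = y].
Proof.
have [->|x0 _] := eqVneq x 0; last first.
  by exists (mx2 x 0 y 1); rewrite unitmx2 !mx2S !mx2E mulr1 mul0r subr0.
rewrite /= => y0; exists (mx2 0 1 y 0).
by rewrite unitmx2 !mx2S !mx2E mulr0 mul1r sub0r oppr_eq0.
Qed.

(* For nilpotent [N = w l^T] with [l^T w = 0], [tr (N C) = l^T C w] vanishes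
   exactly when [w] is an eigenvector of [C]. *)
Lemma nilpotent_eigenline N : \tr N = 0 -> \det N = 0 -> N != 0 ->
  exists2 h, h \in unitmx & forall C, \tr (N *m C) = 0 ->
    (invmx h *m C *m h) 1 0 = 0.
Proof.
elim/mx2_ind: N => n m l x; rewrite !mx2S => e.
have {e}-> : x = - n by apply/eqP; rewrite -addr_eq0 addrC e.
(* The eigenvector is a nonzero column of [N]: the first if [l != 0], otherwise the second, since
   then [n = 0]. *)
move=> d0 N0; have [l0|l0] := eqVneq l 0; last first.
  have [|h [hu h0 h1]] := @conj_first_col n l; first by rewrite l0 orbT.
  exists h => // C; elim/mx2_ind: C => a b c f; rewrite !mx2S => eC.
  apply: conj_lower_left => //; rewrite h0 h1 !mx2E.
  apply/eqP; rewrite -subr_eq0; apply/eqP.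
  have -> : n * (c * n + f * l) - l * (a * n + b * l) =
    - l * (n * a + m * c + (l * b + - n * f)) - c * (n * - n - m * l) by ring.
  by rewrite eC d0 !mulr0 subr0.
have n0 : n = 0.
  by move/eqP: d0; rewrite l0 mulr0 subr0 mulrN oppr_eq0 mulf_eq0 orbb => /eqP.
have m0 : m != 0.
  apply: contraNneq N0 => m0; apply/eqP.
  by apply: eq_mx2; rewrite mx2E mxE ?n0 ?oppr0.
have [|h [hu h0 h1]] := @conj_first_col m 0; first by rewrite m0.
exists h => // C; elim/mx2_ind: C => a b c f; rewrite !mx2S l0 n0 => eC.
apply: conj_lower_left => //; rewrite h0 h1 !mx2E.
move: eC; rewrite oppr0 !mul0r add0r !addr0 mulr0 addr0 mulrA => ->.
by rewrite mul0r.
Qed.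

(** By [tr (N M) = 0] the image line of [N] is an eigenline of [M]; if [M] is nonzero, nilpotency
    makes this line both kernel and image of [M], as it is for [N]. *)
Lemma nilpotent_collinear N M : \tr N = 0 -> \det N = 0 -> N != 0 ->
  \tr M = 0 -> \det M = 0 -> \tr (N *m M) = 0 -> exists c, M = c *: N.
Proof.
elim/mx2_ind: N => n m l x; elim/mx2_ind: M => n' m' l' x'; rewrite !mx2S => e.
have {e}-> : x = - n by apply/eqP; rewrite -addr_eq0 addrC e.
move=> d0 N0 e; have {e}-> : x' = - n' by apply/eqP; rewrite -addr_eq0 addrC e.
move=> d0' e.
have [l0|l0] := eqVneq l 0; last first.
  have e1 : l * n' = l' * n.
    apply/eqP; rewrite -subr_eq0 -sqrf_eq0; apply/eqP.
    transitivity (- l ^+ 2 * (n' * - n' - m' * l') - l' ^+ 2 * (n * - n - m * l)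
      - l * l' * (n * n' + m * l' + (l * m' + - n * - n'))); first by ring.
    by rewrite d0 d0' e !mulr0 !subr0.
  have en : n' = l' / l * n by apply: (mulfI l0); rewrite e1; field.
  exists (l' / l); rewrite mx2S; congr mx2 => //.
  - apply: (mulfI l0); apply: (mulfI l0).
    apply/eqP; rewrite -subr_eq0; apply/eqP.
    transitivity (l * (n * n' + m * l' + (l * m' + - n * - n')) +
       2%:R * l' * (n * - n - m * l)); last by rewrite e d0 !mulr0 addr0.
    by rewrite en; field.
  - by field.
  - by rewrite en mulrN.
have n0 : n = 0.
  by move/eqP: d0; rewrite l0 mulr0 subr0 mulrN oppr_eq0 mulf_eq0 orbb => /eqP.
have m0 : m != 0.
  apply: contraNneq N0 => m0; apply/eqP.
  by apply: eq_mx2; rewrite mx2E mxE ?n0 ?oppr0.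
have l0' : l' = 0.
  move/eqP: e; rewrite l0 n0 oppr0 !mul0r !addr0 add0r mulf_eq0 (negPf m0) /=.
  by move/eqP.
have n0' : n' = 0.
  by move/eqP: d0'; rewrite l0' mulr0 subr0 mulrN oppr_eq0 mulf_eq0 orbb => /eqP.
exists (m' / m); rewrite mx2S l0 n0 l0' n0' oppr0; congr mx2; rewrite ?mulr0 //.
by field.
Qed.

Lemma tr_rot A B C : \tr (A *m B *m C) = \tr (B *m C *m A).
Proof. by rewrite -mulmxA mxtrace_mulC. Qed.

(* If three matrices pairwise share an eigenline but have no common one, the
   eigenlines of [A, B] and [A, C] differ, and [A], [B + C] are irreducible. *)
Lemma irr_triple A B C : \det (cmx A B) = 0 -> \det (cmx A C) = 0 ->
  \tr (A *m B *m C) != \tr (B *m A *m C) -> \det (cmx A (B + C)) != 0.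
Proof.
move=> dB dC; rewrite -subr_eq0 -tr_cmx_mul => nz.
have N0 : cmx A B != 0 by apply: contraNneq nz => ->; rewrite mul0mx raddf0.
have -> : cmx A (B + C) = cmx A B + cmx A C.
  by rewrite /cmx mulmxDr mulmxDl opprD addrACA.
rewrite detD2 dB dC !tr_cmx mulr0 !add0r oppr_eq0.
apply: contraNneq nz => e.
have [c ec] := nilpotent_collinear (tr_cmx _ _) dB N0 (tr_cmx _ _) dC e.
(* [tr ([A, C] B)] is [c tr ([A, B] B) = 0], but it also equals [- tr ([A, B] C)]. *)
have := congr1 (fun X => \tr (X *m B)) ec.
rewrite -scalemxAl mxtraceZ !tr_cmx_mul (tr_rot B A B) subrr mulr0.
rewrite (tr_rot C A B) (tr_rot A C B) (tr_rot C B A).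
by move=> e0; rewrite -opprB e0 oppr0.
Qed.

End TwoByTwo.

(** * Tuples that no invariant separates, and agreement on S(d) *)

Section Tuples.
Variables (F : fieldType) (d : nat).
Implicit Types (u v w : H F d) (p : pexpr F d) (g : 'M[F]_2).

Lemma peval_ext p u v : u =1 v -> peval p u = peval p v.
Proof. by move=> e; elim: p => //= [i j k|p -> q ->|p -> q ->] //; rewrite e. Qed.

(** The complement of [separated], stated positively so that it can be chained as an equivalence
    relation. *)
Definition inv_eq u v := forall p, gl2_invariant p -> peval p u = peval p v.

Lemma inv_eq_sym u v : inv_eq u v -> inv_eq v u.
Proof. by move=> e p hp; rewrite e. Qed.

Lemma inv_eq_trans v u w : inv_eq u v -> inv_eq v w -> inv_eq u w.
Proof. by move=> e e' p hp; rewrite e // e'. Qed.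

Lemma inv_eq_ext u v : u =1 v -> inv_eq u v.
Proof. by move=> e p _; apply: peval_ext. Qed.

Lemma inv_eq_gact g u : g \in unitmx -> inv_eq u (gact g u).
Proof. by move=> gu p hp; rewrite hp. Qed.

Lemma inv_eq_conj g u v : g \in unitmx -> (forall k, u k *m g = g *m v k) ->
  inv_eq u v.
Proof.
move=> gu e; apply: (inv_eq_trans (inv_eq_gact u gu)); apply: inv_eq_ext => k.
by rewrite /gact -mulmxA e mulKmx.
Qed.

(** The indices are arbitrary rather than increasing, so that later arguments need not order
    them. *)
Definition agree u v :=
  [/\ forall i, \tr (u i) = \tr (v i), forall i, \det (u i) = \det (v i),
      forall i j, \tr (u i *m u j) = \tr (v i *m v j) &
      forall i j k, \tr (u i *m u j *m u k) = \tr (v i *m v j *m v k)].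

Lemma agree_sym u v : agree u v -> agree v u.
Proof. by case=> *; split=> *; symmetry. Qed.

Lemma agree_trans v u w : agree u v -> agree v w -> agree u w.
Proof. by move=> [a b c e] [a' b' c' e']; split=> *; rewrite ?a ?b ?c ?e. Qed.

Lemma gact_mul g u i j : g \in unitmx ->
  gact g u i *m gact g u j = invmx g *m (u i *m u j) *m g.
Proof. by move=> gu; rewrite /gact !mulmxA mulmxK. Qed.

Lemma tr_conj g (A : 'M[F]_2) : g \in unitmx -> \tr (invmx g *m A *m g) = \tr A.
Proof. by move=> gu; rewrite mxtrace_mulC mulmxA mulmxV // mul1mx. Qed.

Lemma det_conj g (A : 'M[F]_2) : g \in unitmx -> \det (invmx g *m A *m g) = \det A.
Proof.
by move=> gu; rewrite !det_mulmx mulrAC -det_mulmx mulVmx // det1 mul1r.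
Qed.

Lemma agree_gact g u : g \in unitmx -> agree (gact g u) u.
Proof.
move=> gu; split=> [i|i|i j|i j k]; rewrite ?gact_mul //.
- exact: tr_conj.
- exact: det_conj.
- exact: tr_conj.
- by rewrite /gact !mulmxA !mulmxK // mxtrace_mulC !mulmxA mulmxV // mul1mx.
Qed.

(** Cayley-Hamilton removes repeated indices; rotations and one transposition, via [tr_rot] and
    [tr_mulCA], sort distinct ones. *)
Lemma agree_polar u v : (forall i, \tr (u i) = \tr (v i)) ->
  (forall i, \det (u i) = \det (v i)) ->
  (forall i j : 'I_d, (i < j)%N -> \tr (u i *m u j) = \tr (v i *m v j)) ->
  (forall i j k : 'I_d, (i < j)%N -> (j < k)%N ->
     \tr (u i *m u j *m u k) = \tr (v i *m v j *m v k)) ->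
  agree u v.
Proof.
move=> h1 hd lt2 lt3.
have h2 i j : \tr (u i *m u j) = \tr (v i *m v j).
  case: (ltngtP i j) => [/lt2 //|/lt2|/val_inj ->]; last by rewrite !tr_sqr h1 hd.
  by rewrite mxtrace_mulC => ->; rewrite mxtrace_mulC.
split=> //.
pose P i j k := \tr (u i *m u j *m u k) = \tr (v i *m v j *m v k).
have rotP i j k : P i j k -> P j k i by rewrite /P => e; rewrite -tr_rot e tr_rot.
have swapP i j k : P i j k -> P j i k by rewrite /P (tr_mulCA (u i)) (tr_mulCA (v i)) !h1 !h2 => ->.
have le3 (i j k : 'I_d) : (i <= j)%N -> (j <= k)%N -> P i j k.
  rewrite leq_eqVlt => /orP [/eqP/val_inj ->|ltij].
    by rewrite /P !tr_sqr_mul !h1 !hd !h2.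
  rewrite leq_eqVlt => /orP [/eqP/val_inj ->|ltjk]; last exact: lt3.
  by apply/rotP/rotP; rewrite /P !tr_sqr_mul !h1 !hd !h2.
move=> i j k; rewrite -/(P i j k).
case: (leqP i j) => [ij|/ltnW ji]; case: (leqP j k) => [jk|/ltnW kj].
- exact: le3.
- case: (leqP i k) => [ik|/ltnW ki].
    by apply/rotP/rotP/swapP/rotP/le3.
  by apply/rotP/le3.
- case: (leqP i k) => [ik|/ltnW ki].
    exact/swapP/le3.
  by apply/rotP/rotP/le3.
- by apply/swapP/rotP/le3.
Qed.

Lemma agree_or_separated u v : agree u v \/ exists f, S_d f /\ f u <> f v.
Proof.
case: (boolP [forall i, \tr (u i) == \tr (v i)]) => [h1|/forallPn [i /eqP ne]]; last first.
  by right; exists (fun A => \tr (A i)); split=> //; left; exists i.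
case: (boolP [forall i, \det (u i) == \det (v i)]) => [hd|/forallPn [i /eqP ne]]; last first.
  by right; exists (fun A => \det (A i)); split=> //; right; left; exists i.
case: (boolP [forall i : 'I_d, forall j : 'I_d,
  (i < j)%N ==> (\tr (u i *m u j) == \tr (v i *m v j))]) => [h2|]; last first.
  move=> /forallPn [i /forallPn [j]]; rewrite negb_imply => /andP [ij /eqP ne].
  right; exists (fun A => \tr (A i *m A j)); split=> //.
  by right; right; left; exists i, j.
case: (boolP [forall i : 'I_d, forall j : 'I_d, forall k : 'I_d, (i < j)%N ==> (j < k)%N ==>
    (\tr (u i *m u j *m u k) == \tr (v i *m v j *m v k))]) => [h3|]; last first.
  move=> /forallPn [i /forallPn [j /forallPn [k]]].
  rewrite !negb_imply => /and3P [ij jk /eqP ne].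
  right; exists (fun A => \tr (A i *m A j *m A k)); split=> //.
  by right; right; right; exists i, j, k.
left; apply: agree_polar => [i|i|i j ij|i j k ij jk].
- exact/eqP/(forallP h1).
- exact/eqP/(forallP hd).
- by move/forallP: h2 => /(_ i)/forallP/(_ j); rewrite ij => /eqP.
- by move/forallP: h3 => /(_ i)/forallP/(_ j)/forallP/(_ k); rewrite ij jk => /eqP.
Qed.

(** * Irreducible tuples *)

Lemma inv_eq_irr u v (A B A' B' : 'M[F]_2) :
  \tr A = \tr A' -> \det A = \det A' -> \tr B = \tr B' -> \det B = \det B' ->
  \tr (A *m B) = \tr (A' *m B') -> \det (cmx A B) != 0 ->
  (forall k, [/\ \tr (u k) = \tr (v k), \tr (A *m u k) = \tr (A' *m v k),
     \tr (B *m u k) = \tr (B' *m v k) &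
     \tr (A *m B *m u k) = \tr (A' *m B' *m v k)]) ->
  inv_eq u v.
Proof.
move=> tA dA tB dB tAB nz e.
have [g [gu eA eB]] := irr_conj tA dA tB dB tAB nz.
apply: (inv_eq_conj gu) => k; have [e1 eAk eBk eABk] := e k.
have trJ (Y Y' : 'M[F]_2) : Y *m g = g *m Y' ->
    \tr (Y *m (g *m v k *m invmx g)) = \tr (Y' *m v k).
  by move=> eY; rewrite !mulmxA eY mxtrace_mulC !mulmxA mulVmx // mul1mx.
(* This difference is orthogonal to [1], [A], [B] and [A B] under the trace form. The pair [A, B]
   need not consist of entries of [u], which admits [u_i, u_j + u_k]. *)
suff : u k - g *m v k *m invmx g = 0.
  by move/eqP; rewrite subr_eq0 => /eqP ->; rewrite mulmxKV.
apply: (trace_form_nondeg nz); rewrite ?mulmxBr raddfB /=; apply/eqP;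
  rewrite subr_eq0; apply/eqP.
- by rewrite [RHS]mxtrace_mulC mulKmx.
- by rewrite (trJ A A').
- by rewrite (trJ B B').
- by rewrite (trJ _ (A' *m B')) // -mulmxA eB mulmxA eA mulmxA.
Qed.

Lemma agree_irr_pair u v i j : agree u v -> \det (cmx (u i) (u j)) != 0 -> inv_eq u v.
Proof.
move=> [h1 hd h2 h3] nz.
by apply: (inv_eq_irr (h1 i) (hd i) (h1 j) (hd j) (h2 i j) nz) => k; split.
Qed.

Lemma agree_irr_triple u v i j k : agree u v ->
  \det (cmx (u i) (u j)) = 0 -> \det (cmx (u i) (u k)) = 0 ->
  \tr (u i *m u j *m u k) != \tr (u j *m u i *m u k) -> inv_eq u v.
Proof.
move=> [h1 hd h2 h3] eij eik ne.
have h1' : \tr (u j + u k) = \tr (v j + v k) by rewrite !raddfD /= !h1.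
have h2' : \tr (u i *m (u j + u k)) = \tr (v i *m (v j + v k)).
  by rewrite !mulmxDr !raddfD /= !h2.
have hd' : \det (u j + u k) = \det (v j + v k) by rewrite !detD2 !hd !h1 !h2.
apply: (inv_eq_irr (h1 i) (hd i) h1' hd' h2' (irr_triple eij eik ne)) => l.
by split=> //; rewrite ?mulmxDr !mulmxDl !raddfD /= ?h2 ?h3.
Qed.

(** * Reducible tuples: triangular form or a quadratic field *)

Definition triangularizable u := exists2 g, g \in unitmx & forall k, gact g u k 1 0 = 0.

(** Without a root of its characteristic polynomial, [u_i] generates a quadratic field that is its
    own centralizer, so it contains every [u_k]. *)
Definition in_field u := (forall j k, u j *m u k = u k *m u j) /\
  exists i, forall x, x ^+ 2 - \tr (u i) * x + \det (u i) != 0.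

Lemma charpoly_root_conj u i x : (forall j k, u j *m u k = u k *m u j) ->
  ~~ is_scalar_mx (u i) -> x ^+ 2 - \tr (u i) * x + \det (u i) = 0 ->
  triangularizable u.
Proof.
move=> comm nsc root; have [h hu eh] := companion_conj nsc.
(* [(x - t, 1)], with [t] the trace, is the eigenvector of the companion matrix for the root [x],
   hence of everything commuting with it. *)
have [|g [gu g0 g1]] := @conj_first_col F (x - \tr (u i)) 1; first by rewrite oner_neq0 orbT.
have hgu : h *m g \in unitmx by rewrite unitmx_mul hu.
exists (h *m g) => // k.
have -> : gact (h *m g) u k = invmx g *m (gact h u k) *m g.
  apply: (can_inj (mulKmx hgu)); rewrite /gact -(mulmxA (invmx (h *m g))) mulKVmx //.
  by rewrite !mulmxA !mulmxK // mulmxV // mul1mx.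
apply: conj_lower_left => //; rewrite g0 g1.
have : companion (\tr (u i)) (\det (u i)) *m gact h u k =
    gact h u k *m companion (\tr (u i)) (\det (u i)).
  have -> : companion (\tr (u i)) (\det (u i)) = gact h u i.
    by rewrite /gact -mulmxA eh mulKmx.
  by rewrite !gact_mul // comm.
move/comm_companion => ->; move: (gact h u k 0 0) (gact h u k 1 0) => a b.
rewrite scalar2 /companion !mx2S !mx2E.
apply/eqP; rewrite -subr_eq0; apply/eqP.
transitivity (b * (x ^+ 2 - \tr (u i) * x + \det (u i))); first by ring.
by rewrite root mulr0.
Qed.

(** A nonzero commutator is nilpotent here and its image is a common eigenline. For commuting tuples
    the question is whether a non-scalar entry has an eigenvalue in [F]; this is undecidable in
    general, whence [classically]. *)
Lemma reducible_cases u : (forall i j, \det (cmx (u i) (u j)) = 0) ->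
  (forall i j k, \tr (u i *m u j *m u k) = \tr (u j *m u i *m u k)) ->
  classically (triangularizable u \/ in_field u).
Proof.
move=> ndet ntr.
case: (boolP [exists i, exists j, cmx (u i) (u j) != 0]) => [|ncomm].
  case/existsP=> i /existsP [j nz]; apply/classicW; left.
  have [h hu tri] := nilpotent_eigenline (tr_cmx _ _) (ndet i j) nz.
  by exists h => // k; apply: tri; rewrite tr_cmx_mul ntr subrr.
have comm j k : u j *m u k = u k *m u j.
  by apply/cmx0P; move: ncomm => /existsPn/(_ j)/existsPn/(_ k)/negPn.
case: (boolP [exists i, ~~ is_scalar_mx (u i)]) => [/existsP [i nsc]|/existsPn sc].
  have EM := @classic_EM (exists x, x ^+ 2 - \tr (u i) * x + \det (u i) = 0).
  apply: classic_bind EM => -[[x /(charpoly_root_conj comm nsc) tri]|nroot].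
    by apply/classicW; left.
  apply/classicW; right; split=> //; exists i => x.
  by apply/eqP => root; apply: nroot; exists x.
apply/classicW; left; exists 1%:M => [|k]; first exact: unitmx1.
rewrite /gact invmx1 mul1mx mulmx1.
by move: (sc k) => /negPn/is_scalar_mxP [a ->]; rewrite scalar2 mx2E.
Qed.

(** Conjugation moves [u_i] and [v_i] to the same [c], and both tuples into the field [F[c]], where
    they coincide. The norm is used because the trace form vanishes if [F[c]] is inseparable. *)
Lemma in_field_inv_eq u v : agree u v -> in_field u -> in_field v -> inv_eq u v.
Proof.
move=> a [cu [i nroot]] [cv _].
have a0 := a; have [h1 hd h2 h3] := a0.
have nsc (A : 'M[F]_2) : \tr A = \tr (u i) -> \det A = \det (u i) ->
    ~~ is_scalar_mx A.
  move=> eT eD; apply/is_scalar_mxP => -[x ex]; have /eqP := nroot x; apply.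
  by rewrite -eT -eD ex scalar2 !mx2S; ring.
have [h hu eh] := companion_conj (nsc _ (erefl _) (erefl _)).
have [h' hu' eh'] := companion_conj (nsc (v i) (esym (h1 i)) (esym (hd i))).
rewrite -h1 -hd in eh'; set c := companion _ _ in eh eh'.
have ei : gact h u i = c by rewrite /gact -mulmxA eh mulKmx.
have ei' : gact h' v i = c by rewrite /gact -mulmxA eh' mulKmx.
apply: (inv_eq_trans (inv_eq_gact u hu)).
apply: (inv_eq_trans _ (inv_eq_sym (inv_eq_gact v hu'))).
apply: inv_eq_ext => k.
have [e1 ed e2 _] : agree (gact h u) (gact h' v).
  exact: agree_trans (agree_gact _ hu) (agree_trans a (agree_sym (agree_gact _ hu'))).
have ck : c *m gact h u k = gact h u k *m c by rewrite -ei !gact_mul // cu.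
have ck' : c *m gact h' v k = gact h' v k *m c by rewrite -ei' !gact_mul // cv.
move: (e1 k) (ed k) (e2 i k); rewrite ei ei'.
rewrite (comm_companion ck) (comm_companion ck').
move: (gact h u k 0 0) (gact h u k 1 0) => x y.
move: (gact h' v k 0 0) (gact h' v k 1 0) => x' y'.
move: nroot; rewrite /c /companion; move: (\tr (u i)) (\det (u i)) => t e nroot.
rewrite !scalar2 !mx2S.
set Tu := LHS; set Tv := RHS => eT; set Du := LHS; set Dv := RHS => eD.
set Cu := LHS; set Cv := RHS => eC.
(* [X = (x - x') + (y - y') c] has [tr X = tr (c X) = 0]; as the second tuple lies
   in [F[c]], polarizing [det] gives [det X = 0]. *)
have det0 : (x - x') ^+ 2 + (x - x') * (y - y') * t + (y - y') ^+ 2 * e = 0.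
  transitivity ((Du - Dv) - x' * (Tu - Tv) - y' * (t * (Tu - Tv) - (Cu - Cv))).
    by rewrite /Du /Dv /Tu /Tv /Cu /Cv; ring.
  by rewrite eT eD eC; ring.
have y0 : y = y'.
  apply/eqP; rewrite -subr_eq0; apply: contraT => ny.
  (* A nontrivial zero of the norm form would yield a root of the characteristic polynomial. *)
  have /eqP[] := nroot (- ((x - x') / (y - y'))).
  apply: (mulfI (expf_neq0 2 ny)); rewrite mulr0 -det0; field; exact: ny.
have x0 : x = x'.
  apply/eqP; rewrite -subr_eq0 -sqrf_eq0; apply/eqP.
  by rewrite -det0 y0; ring.
by rewrite x0 y0.
Qed.

(** * Degeneration to diagonal tuples *)

Lemma peval_horner p (U : 'I_d -> 'I_2 -> 'I_2 -> {poly F}) :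
  exists q : {poly F}, forall t, q.[t] = peval p (fun k => \matrix_(i, j) (U k i j).[t]).
Proof.
elim: p => [c|i j k|p [q eq] p' [q' eq']|p [q eq] p' [q' eq']] /=.
- by exists c%:P => t; rewrite hornerC.
- by exists (U k i j) => t; rewrite mxE.
- by exists (q + q') => t; rewrite hornerD eq eq'.
- by exists (q * q') => t; rewrite hornerM eq eq'.
Qed.

Lemma infinite_uniq : infinite_field F -> forall n, exists2 s : seq F, uniq s & size s = n.
Proof.
move=> hF; elim=> [|n [s us ss]]; first by exists [::].
by have [x xs] := hF s; exists (x :: s); rewrite /= ?xs ?ss.
Qed.

(** An algebraic limit at [0]: the factor ['X] in [P] supplies the missing root, so [P] vanishes on
    the whole infinite field. *)
Lemma horner_const (q : {poly F}) c : infinite_field F ->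
  (forall t, t != 0 -> q.[t] = c) -> q.[0] = c.
Proof.
move=> hF e; pose P : {poly F} := 'X * (q - c%:P).
have [s us ss] := infinite_uniq hF (size P).
suff /eqP : P = 0.
  by rewrite mulf_eq0 polyX_eq0 subr_eq0 => /eqP ->; rewrite hornerC.
apply/eqP; apply: contraT => nz.
suff : (size s < size P)%N by rewrite ss ltnn.
apply: max_poly_roots => //; apply/allP => t _.
rewrite /root hornerM hornerX hornerD hornerN hornerC mulf_eq0.
by have [//|/e ->] := eqVneq t 0; rewrite subrr eqxx.
Qed.

(* Conjugation by [diag (1, t)] scales the upper right entries by [t];
   let [t] tend to [0]. *)
Lemma inv_eq_diag u : infinite_field F -> (forall k, u k 1 0 = 0) ->
  inv_eq u (fun k => mx2 (u k 0 0) 0 0 (u k 1 1)).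
Proof.
move=> hF low p hp.
pose U t : H F d := fun k => mx2 (u k 0 0) (u k 0 1 * t) 0 (u k 1 1).
pose Up k i j : {poly F} :=
  if i == 0 :> 'I_2 then (if j == 0 :> 'I_2 then (u k 0 0)%:P else (u k 0 1) *: 'X)
  else (if j == 0 then 0 else (u k 1 1)%:P).
have [q eq] := peval_horner p Up.
have {}eq t : q.[t] = peval p (U t).
  rewrite eq; apply: peval_ext => k; by apply: eq_mx2; rewrite !mx2E mxE /Up /= ?hornerE.
have -> : peval p (fun k => mx2 (u k 0 0) 0 0 (u k 1 1)) = q.[0].
  by rewrite eq; apply: peval_ext => k; rewrite /U mulr0.
symmetry; apply: horner_const => // t t0; rewrite eq; symmetry.
apply: (@inv_eq_conj (mx2 1 0 0 t)) => // [|k].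
  by rewrite unitmx2 !mx2S mul1r mulr0 subr0.
by rewrite [u k]mx2_eta low !mx2S; congr mx2; rewrite ?mx2E; ring.
Qed.

(** Each pair [a k, b k] is known up to order. If [i] keeps its order and [k] changes it, or
    conversely, the mixed trace gives [(a i - b i) * (a k - b k) = 0]. So the order changes
    simultaneously, which is conjugation by a permutation matrix. *)
Lemma inv_eq_diag_pair (a b a' b' : 'I_d -> F) :
  (forall k, a k + b k = a' k + b' k) -> (forall k, a k * b k = a' k * b' k) ->
  (forall i j, a i * a j + b i * b j = a' i * a' j + b' i * b' j) ->
  inv_eq (fun k => mx2 (a k) 0 0 (b k)) (fun k => mx2 (a' k) 0 0 (b' k)).
Proof.
move=> eT eD e2.
have swap k : (a k = a' k /\ b k = b' k) \/ (a k = b' k /\ b k = a' k).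
  have : (a k - a' k) * (a k - b' k) = 0.
    transitivity (a k * (a k - (a' k + b' k)) + a' k * b' k); first by ring.
    by rewrite -eT -eD; ring.
  move/eqP; rewrite mulf_eq0 !subr_eq0 => /orP [] /eqP e; [left|right]; split=> //.
    by apply: (addrI (a k)); rewrite eT e.
  by apply: (addrI (a k)); rewrite eT e addrC.
case: (boolP [exists i, a i != b i]) => [/existsP [i ne]|/existsPn ab]; last first.
  apply: inv_eq_ext => k; move: (ab k) => /negPn/eqP e.
  by case: (swap k) => [[-> ->] //|[<- <-]]; rewrite e.
have other k : (a i - b i) * (a k - b k) = 0 -> a k = b k.
  by move/eqP; rewrite mulf_eq0 !subr_eq0 (negPf ne) => /eqP.
case: (swap i) => [[ea eb]|[ea eb]].
  apply: inv_eq_ext => k; case: (swap k) => [[-> ->] //|[eak ebk]].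
  suff e : a k = b k by rewrite -eak -ebk e.
  apply: other; have := e2 i k; rewrite -ea -eb -eak -ebk => e.
  by transitivity (a i * a k + b i * b k - (a i * b k + b i * a k));
    [ring | rewrite e subrr].
apply: (@inv_eq_conj (mx2 0 1 1 0)) => [|k].
  by rewrite unitmx2 !mx2S mul0r mul1r sub0r oppr_eq0 oner_neq0.
rewrite !mx2S; case: (swap k) => [[eak ebk]|[-> ->]]; last by congr mx2; ring.
have e : a k = b k.
  apply: other; have := e2 i k; rewrite -ea -eb -eak -ebk => e.
  by transitivity (a i * a k + b i * b k - (b i * a k + a i * b k));
    [ring | rewrite e subrr].
by rewrite -eak -ebk e; congr mx2; ring.
Qed.

Lemma triangularizable_inv_eq u v : infinite_field F -> agree u v ->
  triangularizable u -> triangularizable v -> inv_eq u v.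
Proof.
move=> hF a [g gu low] [g' gu' low'].
have [e1 ed e2 _] : agree (gact g u) (gact g' v).
  exact: agree_trans (agree_gact _ gu) (agree_trans a (agree_sym (agree_gact _ gu'))).
apply: (inv_eq_trans (inv_eq_gact u gu)).
apply: (inv_eq_trans _ (inv_eq_sym (inv_eq_gact v gu'))).
apply: (inv_eq_trans (inv_eq_diag hF low)).
apply: (inv_eq_trans _ (inv_eq_sym (inv_eq_diag hF low'))).
move: (gact g u) (gact g' v) low low' e1 ed e2 => U V low low' e1 ed e2.
apply: inv_eq_diag_pair => [k|k|i j].
- by rewrite -!mxtrace2.
- by have := ed k; rewrite !det2 low low' !mulr0 !subr0.
- by have := e2 i j; rewrite !mxtrace2 !mulmx2 !low !low' !mulr0 !mul0r !addr0 !add0r.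
Qed.

(** A diagonal entry of the triangular form of [u_i] is a root of the characteristic polynomial that
    [u_i] shares with [v_i]. *)
Lemma triangularizable_not_in_field u v : agree u v ->
  triangularizable u -> ~ in_field v.
Proof.
move=> a [g gu low] [_ [i nroot]].
have [e1 ed _ _] := agree_trans (agree_gact _ gu) a.
have /eqP := nroot (gact g u i 0 0); apply.
by rewrite -e1 -ed mxtrace2 det2 low; ring.
Qed.

(** * The separation property *)

Lemma agree_inv_eq u v : infinite_field F -> agree u v -> inv_eq u v.
Proof.
move=> hF a; have [h1 hd h2 h3] := a.
case: (boolP [exists i, exists j, \det (cmx (u i) (u j)) != 0]).
  by case/existsP=> i /existsP [j]; apply: agree_irr_pair.
move=> /existsPn ndet.
have {}ndet i j : \det (cmx (u i) (u j)) = 0.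
  by move/existsPn: (ndet i) => /(_ j)/negPn/eqP.
case: (boolP [exists i, exists j, exists k,
  \tr (u i *m u j *m u k) != \tr (u j *m u i *m u k)]).
  by case/existsP=> i /existsP [j /existsP [k]]; apply: agree_irr_triple.
move=> /existsPn ntr.
have {}ntr i j k : \tr (u i *m u j *m u k) = \tr (u j *m u i *m u k).
  by move/existsPn: (ntr i) => /(_ j)/existsPn/(_ k)/negPn/eqP.
(* With a boolean goal the [classically] statements can be eliminated. *)
move=> p hp; apply/eqP.
apply: (reducible_cases ndet ntr) => cu.
have cv : classically (triangularizable v \/ in_field v).
  (* Both reducibility conditions are expressed by agreed traces and determinants, so they pass from
     [u] to [v]. *)
  by apply: reducible_cases => *; rewrite ?det_cmx -?h3 // -h1 -h1 -hd -hd -h2 -det_cmx.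
apply: cv => cv; apply/eqP.
suff : inv_eq u v by apply.
case: cu cv => [tu|fu] [tv|fv].
- exact: triangularizable_inv_eq.
- by case: (triangularizable_not_in_field a tu).
- by case: (triangularizable_not_in_field (agree_sym a) tv).
- exact: in_field_inv_eq.
Qed.

(** * Invariance and minimality of S(d) *)

Definition pvar_mx k : 'I_2 -> 'I_2 -> pexpr F d := fun a b => PVar F a b k.

Definition pmul_mx (P Q : 'I_2 -> 'I_2 -> pexpr F d) a b :=
  PAdd (PMul (P a 0) (Q 0 b)) (PMul (P a 1) (Q 1 b)).

Lemma S_d_invariant (f : H F d -> F) : S_d f ->
  exists p : pexpr F d, gl2_invariant p /\ (forall A, peval p A = f A).
Proof.
have inv p (h : H F d -> F) : (forall A, peval p A = h A) ->
    (forall g A, g \in unitmx -> h (gact g A) = h A) ->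
    exists p : pexpr F d, gl2_invariant p /\ (forall A, peval p A = h A).
  by move=> e hinv; exists p; split=> // g gu A; rewrite !e hinv.
case=> [[i ->]|[[i ->]|[[i [j [_ ->]]]|[i [j [k [_ [_ ->]]]]]]]].
- apply: (inv (PAdd (pvar_mx i 0 0) (pvar_mx i 1 1))) => [A|g A gu].
    by rewrite mxtrace2.
  by have [-> _ _ _] := agree_gact A gu.
- apply: (inv (PAdd (PMul (pvar_mx i 0 0) (pvar_mx i 1 1))
    (PMul (PConst d (- 1)) (PMul (pvar_mx i 0 1) (pvar_mx i 1 0))))) => [A|g A gu].
    by rewrite det2 /= mulN1r.
  by have [_ -> _ _] := agree_gact A gu.
- pose P := pmul_mx (pvar_mx i) (pvar_mx j).
  apply: (inv (PAdd (P 0 0) (P 1 1))) => [A|g A gu].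
    by rewrite mxtrace2 !mulmx2.
  by have [_ _ -> _] := agree_gact A gu.
- pose P := pmul_mx (pmul_mx (pvar_mx i) (pvar_mx j)) (pvar_mx k).
  apply: (inv (PAdd (P 0 0) (P 1 1))) => [A|g A gu].
    by rewrite mxtrace2 !mulmx2.
  by have [_ _ _ ->] := agree_gact A gu.
Qed.

(** The first match wins, so repeating indices gives tuples supported on one or two positions. *)
Definition tuple3 i j k (A B C : 'M[F]_2) : H F d :=
  fun l => if l == i then A else if l == j then B else if l == k then C else 0.

Lemma tuple3_out i j k A B C l : l \notin [:: i; j; k] -> tuple3 i j k A B C l = 0.
Proof. by rewrite /tuple3 !inE !negb_or => /and3P [/negPf-> /negPf-> /negPf->]. Qed.

Lemma tr2_tuple3 i j k A B C a b : \tr (tuple3 i j k A B C a *m tuple3 i j k A B C b) <> 0 ->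
  (a \in [:: i; j; k]) && (b \in [:: i; j; k]).
Proof.
case: (boolP (a \in _)) => [_|/tuple3_out ->]; last by rewrite mul0mx raddf0.
by case: (boolP (b \in _)) => [//|/tuple3_out ->]; rewrite mulmx0 raddf0.
Qed.

Lemma tr3_tuple3 i j k A B C a b c :
  \tr (tuple3 i j k A B C a *m tuple3 i j k A B C b *m tuple3 i j k A B C c) <> 0 ->
  [&& a \in [:: i; j; k], b \in [:: i; j; k] & c \in [:: i; j; k]].
Proof.
case: (boolP (a \in _)) => [_|/tuple3_out ->]; last by rewrite !mul0mx raddf0.
case: (boolP (b \in _)) => [_|/tuple3_out ->]; last by rewrite mulmx0 mul0mx raddf0.
by case: (boolP (c \in _)) => [//|/tuple3_out ->]; rewrite mulmx0 raddf0.
Qed.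

(** Traces, determinants and double traces are isolated by comparing with zero the tuples built from
    [e11] (determinant 0), from [e12 + e21] (trace 0, determinant -1), and from the nilpotent pair
    [e12, e21]. *)
Lemma S_d_irredundant (f : H F d -> F) : S_d f ->
  exists u v, f u <> f v /\ forall f', S_d f' -> f' u <> f' v -> f' = f.
Proof.
pose e12 : 'M[F]_2 := mx2 0 1 0 0; pose e21 : 'M[F]_2 := mx2 0 0 1 0.
pose e11 : 'M[F]_2 := mx2 1 0 0 0.
pose z : H F d := fun=> 0.
pose simp := (mulr0, mul0r, mulr1, addr0, add0r, subr0, sub0r, oppr0, mul0mx, mulmx0).
have det00 : \det (0 : 'M[F]_2) = 0 by exact: det0.
have tr00 : \tr (0 : 'M[F]_2) = 0 by exact: raddf0.
case=> [[i ->]|[[i ->]|[[i [j [ij ->]]]|[i [j [k [ij [jk ->]]]]]]]].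
- exists (tuple3 i i i e11 0 0), z; split.
    by rewrite /tuple3 eqxx /z tr00 mx2S addr0; apply/eqP/oner_neq0.
  move=> _ [[a ->]|[[a ->]|[[a [b [ab ->]]]|[a [b [c [ab [bc ->]]]]]]]]; rewrite /z ?simp ?tr00 ?det00.
  + by have [-> //|na] := eqVneq a i; rewrite tuple3_out ?tr00 // !inE (negPf na).
  + by rewrite /tuple3; case: ifP => _; rewrite ?if_same ?det00 // mx2S !simp.
  + by move/tr2_tuple3; rewrite !inE -!val_eqE /=; lia.
  + by move/tr3_tuple3; rewrite !inE -!val_eqE /=; lia.
- exists (tuple3 i i i (e12 + e21) 0 0), z; split.
    by rewrite /tuple3 eqxx /z det00 !mx2S !simp; apply/eqP; rewrite oppr_eq0 oner_neq0.
  move=> _ [[a ->]|[[a ->]|[[a [b [ab ->]]]|[a [b [c [ab [bc ->]]]]]]]]; rewrite /z ?simp ?tr00 ?det00.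
  + by rewrite /tuple3; case: ifP => _; rewrite ?if_same ?tr00 // !mx2S !simp.
  + by have [-> //|na] := eqVneq a i; rewrite tuple3_out ?det00 // !inE (negPf na).
  + by move/tr2_tuple3; rewrite !inE -!val_eqE /=; lia.
  + by move/tr3_tuple3; rewrite !inE -!val_eqE /=; lia.
- exists (tuple3 i j j e12 e21 0), z; split.
    have ji : (j == i) = false by rewrite -val_eqE /=; lia.
    by rewrite /tuple3 !eqxx ji /z mul0mx tr00 !mx2S !simp; apply/eqP/oner_neq0.
  move=> _ [[a ->]|[[a ->]|[[a [b [ab ->]]]|[a [b [c [ab [bc ->]]]]]]]]; rewrite /z ?simp ?tr00 ?det00.
  + by rewrite /tuple3; do 2![case: ifP => _; first by rewrite mx2S addr0]; rewrite if_same tr00.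
  + by rewrite /tuple3; do 2![case: ifP => _; first by rewrite mx2S !simp]; rewrite if_same det00.
  + move/tr2_tuple3; rewrite !inE -!val_eqE /= => ab_ij.
    have [/val_inj -> /val_inj -> //] : a = i :> nat /\ b = j :> nat by lia.
  + by move/tr3_tuple3; rewrite !inE -!val_eqE /=; lia.
(* Transposition preserves traces, determinants and double traces but reverses triple products:
   [tr (e12 e21 e11) = 1], while [tr (e11 e21 e12) = 0]. *)
- pose u := tuple3 i j k e12 e21 e11; exists u, (fun l => (u l)^T); split.
    have ji : (j == i) = false by rewrite -val_eqE /=; lia.
    have ki : (k == i) = false by rewrite -val_eqE /=; lia.
    have kj : (k == j) = false by rewrite -val_eqE /=; lia.
    rewrite -!trmx_mul mxtrace_tr mulmxA /u /tuple3 !eqxx ji ki kj !mx2S !simp.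
    by apply/eqP/oner_neq0.
  move=> _ [[a ->]|[[a ->]|[[a [b [ab ->]]]|[a [b [c [ab [bc ->]]]]]]]].
  + by rewrite mxtrace_tr.
  + by rewrite det_tr.
  + by rewrite -trmx_mul mxtrace_tr mxtrace_mulC.
  + rewrite -!trmx_mul mxtrace_tr mulmxA.
    (* Three increasing indices among [i < j < k] are [i, j, k]. *)
    have sorted : [&& a \in [:: i; j; k], b \in [:: i; j; k] & c \in [:: i; j; k]] ->
        (fun A : H F d => \tr (A a *m A b *m A c)) = (fun A => \tr (A i *m A j *m A k)).
      rewrite !inE -!val_eqE /= => abc.
      have [/val_inj -> /val_inj -> /val_inj -> //] :
        [/\ a = i :> nat, b = j :> nat & c = k :> nat] by split; lia.
    case: (eqVneq (\tr (u a *m u b *m u c)) 0) => [->|/eqP/tr3_tuple3 abc _]; last exact: sorted.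
    case: (eqVneq (\tr (u c *m u b *m u a)) 0) => [-> //|/eqP/tr3_tuple3 cba _].
    by apply: sorted; case/and3P: cba => -> -> ->.
Qed.

End Tuples.

Theorem theorem1 (F : fieldType) (d : nat) (hF : infinite_field F) (hd : (1 <= d)%N) :
  (* S(d) is a subset of R^{GL(2)} *)
  (forall f : H F d -> F, S_d f ->
     exists p : pexpr F d, gl2_invariant p /\ (forall A : H F d, peval p A = f A)) /\
  (* S(d) is separating *)
  separating (@S_d F d) /\
  (* no proper subset of S(d) is separating *)
  (forall T : (H F d -> F) -> Prop,
     (forall f : H F d -> F, T f -> S_d f) ->
     (exists f : H F d -> F, S_d f /\ ~ T f) -> ~ separating T).
Proof.
split; first exact: S_d_invariant.
split=> [u v [p [hp ne]]|T TS [f [Sf nTf]] sepT].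
  by case: (agree_or_separated u v) => // /(agree_inv_eq hF) /(_ p hp).
(* The pair separated within S(d) by [f] alone is separated by an invariant, but not by [T]. *)
have [p [hp pf]] := S_d_invariant Sf.
have [u [v [ne only]]] := S_d_irredundant Sf.
have [|f' [Tf' ne']] := sepT u v; first by exists p; rewrite !pf.
by apply: nTf; rewrite -(only f' (TS _ Tf') ne').
Qed.
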